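(* For every index set $I$ (in an ordered field $\mathbb{F}$) there is a Latin square $L$ on $I$ such that for no bijection $\pi:I\to I$ is the square $L^\pi(i,j)=L(i,\pi(j))$ row-complete.
   Context: Let $\mathbb{F}$ be an ordered field and $I\subseteq\mathbb{F}$; for $d\in\mathbb{F}^+$ put $I_{(d)}=\{i\in I:i+d\in I\}$. $I$ is an index set if $|I|=|\mathbb{F}|$ and for every $d\in\mathbb{F}^+$ either $|I_{(d)}|=|\mathbb{F}|$ or $I_{(d)}=\emptyset$. A Latin square on $I$ with symbol set $X$ is a function $L:I\times I\to X$ such that for each $i\in I$ both $j\mapsto L(i,j)$ and $j\mapsto L(j,i)$ are bijections $I\to X$. $L$ is row-complete if for every ordered pair $(x,y)$ of distinct symbols there is exactly one pair $(i,j)$ with $j\in I_{(1)}$, $L(i,j)=x$ and $L(i,j+1)=y$. *)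

(* Defs.v *)
From mathcomp Require Import all_boot all_order all_algebra.
From mathcomp Require Import boolp classical_sets functions cardinality.

Set Implicit Arguments.
Unset Strict Implicit.
Unset Printing Implicit Defensive.

Import GRing.Theory.

Local Open Scope ring_scope.
Local Open Scope classical_set_scope.
Local Open Scope card_scope.

(* An ordered field is a [realFieldType].  Functions defined on a subset I of F
   are represented by total functions on F; only their values on I matter. *)

Definition shift_dom (F : realFieldType) (I : set F) (d : F) : set F :=
  [set i | I i /\ I (i + d)].

Definition index_set (F : realFieldType) (I : set F) : Prop :=
  I #= [set: F] /\
  forall d : F, 0 < d -> shift_dom I d #= [set: F] \/ shift_dom I d = set0.

Definition latin_square (F : realFieldType) (I : set F)
    (U : Type) (X : set U) (L : F -> F -> U) : Prop :=
  forall i : F, I i ->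
    set_bij I X (fun j => L i j) /\ set_bij I X (fun j => L j i).

Definition row_complete (F : realFieldType) (I : set F)
    (U : Type) (X : set U) (L : F -> F -> U) : Prop :=
  forall x y : U, X x -> X y -> x <> y ->
    exists! ij : F * F,
      [/\ I ij.1, shift_dom I 1 ij.2, L ij.1 ij.2 = x & L ij.1 (ij.2 + 1) = y].

Definition permute_columns (F : realFieldType) (U : Type)
    (L : F -> F -> U) (p : F -> F) : F -> F -> U :=
  fun i j => L i (p j).

(* Main.v *)
(* Let G = Z/2 x Z/2 x F, of the same cardinality as I, let h be an involution
   of G and let e : G -> Z/2 be invariant under translation by h and
   change its value under every translation by some d.  In the addition table
   of G the rows 0 and h form, with the columns a and a + h, an intercalate;
   switch it whenever e a = 1.  Call a pair of consecutive columns (a, b) an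
   edge.  Its columns contain, in all rows but two, the pairs (x, x + (b - a)),
   so distinct edges have distinct differences.  If the columns were ordered
   row-completely, some edge (a, a + d) would exist, as the only other source of
   the pairs (x, x + d) is an edge of difference d + h, which supplies just two.
   Since e a <> e (a + d), the pair (a, a + d) does not occur in the columns of
   this edge, and only an edge of difference d + h leaving a or a + h can supply
   it.  That edge is (a, a + d + h) or (a + h, a + d), so it shares with
   (a, a + d) its source or its target but not both, which is impossible. *)
Require Import Defs.
From HB Require Import structures.
From mathcomp Require Import all_boot all_order all_algebra.
From mathcomp Require Import boolp classical_sets functions cardinality.

Import Order.TTheory GRing.Theory Num.Theory.
Local Open Scope ring_scope.

Section SwitchedTable.

Variables (G : zmodType) (h : G) (e : G -> bool).
Hypotheses (h_neq0 : h != 0) (hh : h + h = 0) (e_h : forall a, e (a + h) = e a).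

(** In columns [a] and [a + h], rows [0] and [h] hold only the symbols [a] and [a + h]; adding [h]
    swaps these. *)
Definition switched_table (g a : G) : G :=
  g + a + h *+ ((g \in [:: 0; h]) && e a).

Local Notation T := switched_table.

Let h_addb (b c : bool) : h *+ b + h *+ c = h *+ (b (+) c).
Proof. by case: b c => [] []; rewrite /= ?mulr1n ?addr0 ?add0r. Qed.

Let h_addbK (x : G) (b : bool) : x + h *+ b + h *+ b = x.
Proof. by rewrite -addrA h_addb addbb mulr0n addr0. Qed.

Let e_hb (a : G) (b : bool) : e (a + h *+ b) = e a.
Proof. by case: b; rewrite ?mulr1n ?mulr0n ?addr0. Qed.

Let subgroup_h (g : G) (b : bool) :
  (g + h *+ b \in [:: 0; h]) = (g \in [:: 0; h]).
Proof.
have hN : - h = h by rewrite -[LHS]addr0 -hh addKr.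
case: b; rewrite ?mulr1n ?mulr0n ?addr0 // !inE orbC.
by rewrite addr_eq0 hN -[g + h == h]subr_eq0 addrK.
Qed.

Lemma bij_switched_table_row (g : G) : bijective (T g).
Proof.
(* [e] ignores shifts by [h], so [e (x - g)] still tells whether the entry was switched. *)
exists (fun x => x - g + h *+ ((g \in [:: 0; h]) && e (x - g))) => a;
  set m := g \in _; rewrite /T -/m.
- have -> : g + a + h *+ (m && e a) - g = a + h *+ (m && e a).
    by rewrite addrAC [g + a]addrC addrK.
  by rewrite e_hb h_addbK.
- by rewrite e_hb addrA [g + _]addrC subrK h_addbK.
Qed.

Lemma bij_switched_table_col (a : G) : bijective (T ^~ a).
Proof.
exists (fun x => x - a + h *+ ((x - a \in [:: 0; h]) && e a)) => x; rewrite /T.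
- set c := h *+ (_ && _).
  have -> : x + a + c - a = x + c by rewrite addrAC addrK.
  by rewrite subgroup_h h_addbK.
- by rewrite subgroup_h [_ + a]addrAC subrK h_addbK.
Qed.

Lemma switched_table_out (g a : G) : g \notin [:: 0; h] -> T g a = g + a.
Proof. by rewrite /T => /negbTE ->; rewrite addr0. Qed.

Lemma switched_table_diff (g a b x u : G) : T g a = x -> T g b = x + u ->
  b = a + (u + h *+ ((g \in [:: 0; h]) && (e a (+) e b))).
Proof.
move=> <-; rewrite /T; case: (g \in _) => /=; last first.
  by rewrite !addr0 -addrA => /addrI.
move=> E; apply: (addrI g); apply: (addIr (h *+ e b)).
by rewrite E -h_addb !addrA h_addbK addrAC.
Qed.

Lemma flip_neq0 (u : G) : (forall a, e (a + u) = ~~ e a) -> u != 0.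
Proof.
by move=> e_u; apply/eqP => u0; have := e_u 0; rewrite u0 addr0; case: (e 0).
Qed.

Lemma eq_addl_self (x u : G) : x = x + u -> u = 0.
Proof. by rewrite -[X in X = _]addr0 => /addrI. Qed.

Section Edges.

Hypothesis G_large :
  forall a b : G, exists x, (x - a \notin [:: 0; h]) && (x - b \notin [:: 0; h]).

Variable E : G -> G -> Prop.
Hypothesis E_fun : forall a b b', E a b -> E a b' -> b = b'.
Hypothesis E_inj : forall a a' b, E a b -> E a' b -> a = a'.
Hypothesis E_cover :
  forall x y, x <> y -> exists g a b, [/\ E a b, T g a = x & T g b = y].
Hypothesis E_uniq : forall g a b g' a' b', E a b -> E a' b' ->
  T g a = T g' a' -> T g b = T g' b' -> T g a <> T g b -> a = a'.

(* Both edges contain the pair (x, x + u), for x avoiding the switched rows. *)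
Lemma edge_diff_inj (u a a' : G) :
  u != 0 -> E a (a + u) -> E a' (a' + u) -> a = a'.
Proof.
move=> u0 Ea Ea'; have [x /andP[xa xa']] := G_large a a'.
apply: (E_uniq (x - a) _ _ (x - a') _ _ Ea Ea');
  rewrite !switched_table_out // ?addrA !subrK //.
by move=> /eq_addl_self /eqP; rewrite (negbTE u0).
Qed.

(** Both [u] and [u + h] change [e], so in a switched row exactly one of the two entries is shifted
    by [h]. *)
Lemma edge_covering_flip (u x : G) : (forall a, e (a + u) = ~~ e a) ->
  exists g a, T g a = x /\
    ((g \notin [:: 0; h] /\ E a (a + u)) \/
     (g \in [:: 0; h] /\ E a (a + (u + h)))).
Proof.
move=> e_u; have [|g [a [b [Eab Ta Tb]]]] := E_cover x (x + u).
  by move/eq_addl_self/eqP; rewrite (negbTE (flip_neq0 _ e_u)).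
exists g, a; split=> //; have := switched_table_diff _ _ _ _ _ Ta Tb.
case: (boolP (g \in _)) => gH Db; [right|left]; split=> //; last first.
  by rewrite /= mulr0n addr0 in Db; rewrite -Db.
suff eab : e a (+) e b by rewrite eab /= mulr1n in Db; rewrite -Db.
by rewrite Db addrA e_hb e_u; case: (e a).
Qed.

Lemma switched_table_in (g a : G) : g \in [:: 0; h] ->
  exists b : bool, a = T g a + h *+ b.
Proof.
rewrite /T => gH; rewrite gH /=; move: gH; rewrite !inE => /orP[] /eqP->.
  by exists (e a); rewrite add0r h_addbK.
by exists (~~ e a); rewrite [h + a]addrC -!addrA h_addb addbN addbb mulr1n hh addr0.
Qed.

Lemma exists_flip_edge (u : G) :
  (forall a, e (a + u) = ~~ e a) -> exists a, E a (a + u).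
Proof.
move=> e_u.
have e_uh a : e (a + (u + h)) = ~~ e a by rewrite addrA e_h.
have [g [a [Ta [[_ Ea]|[gH Ea]]]]] := edge_covering_flip u 0 e_u; first by exists a.
(* In the switched rows, a single edge supplies only pairs starting in one coset of [{0, h}], so it
   cannot serve both [0] and an [x] outside [{0, h}]. *)
have [x /andP[xH _]] := G_large 0 0; rewrite subr0 in xH.
have [g' [a' [Ta' [[_ Ea']|[gH' Ea']]]]] := edge_covering_flip u x e_u.
  by exists a'.
have aa' := edge_diff_inj _ _ _ (flip_neq0 _ e_uh) Ea Ea'.
have [c Dc] := switched_table_in g a gH.
have [c' Dc'] := switched_table_in g' a' gH'.
move: xH; rewrite -(subgroup_h x c') -Ta' -Dc' -aa' Dc Ta add0r.
by case: (c); rewrite !inE eqxx ?orbT.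
Qed.

Lemma no_flip (d : G) : ~ (forall a, e (a + d) = ~~ e a).
Proof.
move=> e_d; have [a Ea] := exists_flip_edge d e_d.
have hN0 : h <> 0 by apply/eqP.
have [g [a' [Ta' [[gH Ea']|[gH Ea']]]]] := edge_covering_flip d a e_d.
  (* The same edge again would force [g = 0], a switched row. *)
  have aa' := edge_diff_inj _ _ _ (flip_neq0 _ e_d) Ea Ea'.
  move: gH Ta'; rewrite -aa' => gH; rewrite switched_table_out // addrC.
  by move/esym/eq_addl_self => g0; rewrite g0 inE eqxx in gH.
have [[] Da'] := switched_table_in g a' gH; rewrite Ta' ?mulr1n ?addr0 in Da'.
(* [a' = a + h]: both edges end at [a + d]. *)
- apply: hN0; apply: (eq_addl_self a); rewrite -Da'.
  apply: E_inj Ea _; move: Ea'; rewrite Da'.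
  by rewrite [d + h]addrC !addrA -[a + h + h]addrA hh addr0.
(* [a' = a]: both edges leave [a]. *)
- rewrite Da' in Ea'; apply: hN0; apply: (eq_addl_self (a + d)).
  by rewrite -addrA; exact: E_fun Ea Ea'.
Qed.

End Edges.
End SwitchedTable.

Lemma bool_prod_inj (F : realFieldType) :
  exists k : bool -> F -> F, forall b c x y, k b x = k c y -> b = c /\ x = y.
Proof.
(* [q] sends nonnegatives into [[1, +oo)] and negatives into [(0, 1)]; [- q] gives a disjoint second
   copy of [F]. *)
pose q (x : F) := if 0 <= x then x + 1 else (1 - x)^-1.
have q_gt0 x : 0 < q x.
  rewrite /q; case: (leP 0 x) => x0; first by rewrite ltr_wpDl.
  by rewrite invr_gt0 subr_gt0 (lt_trans x0).
have q_ge1 x : (1 <= q x) = (0 <= x).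
  rewrite /q; case: (leP 0 x) => x0; first by rewrite lerDr.
  have x1 : 0 < 1 - x by rewrite subr_gt0 (lt_trans x0).
  by rewrite -[leLHS]invr1 lef_pV2 ?posrE // gerDl leNgt oppr_gt0 x0.
have q_inj : injective q.
  move=> x y qxy; have := q_ge1 y; rewrite -qxy q_ge1 => x0y.
  move: qxy; rewrite /q x0y; case: ifP => _; first by move/addIr.
  by move/invr_inj/addrI/oppr_inj.
exists (fun b x => if b then q x else - q x) => -[] [] x y.
- by move/q_inj.
- by move=> E; have := q_gt0 x; rewrite E oppr_gt0 ltNge (ltW (q_gt0 y)).
- by move=> E; have := q_gt0 y; rewrite -E oppr_gt0 ltNge (ltW (q_gt0 x)).
- by move/oppr_inj/q_inj.
Qed.

Local Open Scope classical_set_scope.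
Local Open Scope card_scope.

Lemma injective_card_le (T U : Type) (f : T -> U) :
  injective f -> [set: T] #<= [set: U].
Proof.
move=> f_inj; have [|g] := (@injfunPex T U setT setT).2; last exact: inj_card_le.
by exists f => // x y _ _ /f_inj.
Qed.

Lemma card_eq_set_bij (T : Type) (U : choiceType) (u : U) (A : set T) (B : set U) :
  A #= B -> exists f : T -> U, set_bij A B f.
Proof.
pose V : pointedType := HB.pack (Choice.sort U) (isPointed.Build U u).
by move/(@card_set_bijP T V).
Qed.

Lemma card_boolX2 (F : realFieldType) : [set: F] #= [set: bool * bool * F].
Proof.
have [k k_inj] := bool_prod_inj F.
rewrite card_eq_le; apply/andP; split.
- by apply: (@injective_card_le _ _ (fun x => (false, false, x))) => x y [].
- apply: (@injective_card_le _ _ (fun z => k z.1.1 (k z.1.2 z.2))).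
  by move=> [[a b] x] [[a' b'] y] /= /k_inj[-> /k_inj[-> ->]].
Qed.

Theorem theorem3p1 (F : realFieldType) (I : set F) (hI : index_set I) :
  exists (U : Type) (X : set U) (L : F -> F -> U),
    latin_square I X L /\
    forall p : F -> F, set_bij I I p ->
      ~ row_complete I X (permute_columns L p).
Proof.
pose G : zmodType := (bool * bool * F)%type.
pose h : G := (true, false, 0); pose d : G := (false, true, 0).
pose e : G -> bool := fun z => z.1.2.
have h_neq0 : h != 0 by [].
have hh : h + h = 0 by congr (_, _, _); exact: addr0.
have e_h a : e (a + h) = e a by rewrite /e /=; exact: addr0.
have e_d a : e (a + d) = ~~ e a by rewrite /e /=; case: a.1.2.
have G_large (a b : G) :
    exists x, (x - a \notin [:: 0; h]) && (x - b \notin [:: 0; h]).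
  (* The last coordinate of [x - a] and [x - b] is then positive, while that of [0] and [h] is
     zero. *)
  exists (false, false, 1 + `|a.2| + `|b.2|).
  have ne (c : G) : 0 < (c.2 : F) -> c \notin [:: 0; h].
    move=> c0; rewrite !inE; apply/norP.
    by split; apply: contraTneq c0 => ->; rewrite ltxx.
  apply/andP; split; apply: ne => /=;
    rewrite subr_gt0 (le_lt_trans (ler_norm _)) //.
  - by rewrite addrAC ltrDr ltr_wpDr.
  - by rewrite ltrDr ltr_wpDr.
have [f f_bij] : exists f : F -> G, set_bij I setT f.
  exact: card_eq_set_bij 0 _ _ (card_eq_trans hI.1 (card_boolX2 F)).
have [_ f_inj f_surj] := f_bij.
pose T := switched_table G h e.
exists G, setT, (fun i j => T (f i) (f j)); split=> [i Ii|p p_bij rc].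
  split.
  - apply: (set_bij_comp f_bij (g := T (f i))).
    by rewrite setTT_bijective; exact: bij_switched_table_row.
  - apply: (set_bij_comp f_bij (g := T ^~ (f i))).
    by rewrite setTT_bijective; exact: bij_switched_table_col.
have [p_hom p_inj _] := p_bij.
have fp_inj i j : I i -> I j -> f (p i) = f (p j) -> i = j.
  move=> Ii Ij /f_inj fij; apply: p_inj; rewrite ?inE //.
  by apply: fij; rewrite inE; exact: p_hom.
pose E (a b : G) := exists j, [/\ shift_dom I 1 j, f (p j) = a & f (p (j + 1)) = b].
apply: (@no_flip G h e h_neq0 hh e_h G_large E _ _ _ _ d e_d).
- move=> a b b' [j [[Ij _] <- <-]] [j' [[Ij' _] /fp_inj + <-]].
  by move=> /(_ Ij' Ij) ->.
- move=> a a' b [j [[_ Ij] <- <-]] [j' [[_ Ij'] <- /fp_inj]].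
  by move=> /(_ Ij' Ij) /addIr ->.
- move=> x y xy; have [[i j] [[/= Ii sj Lx Ly] _]] := rc x y Logic.I Logic.I xy.
  by exists (f i), (f (p j)), (f (p (j + 1))); split=> //; exists j.
- move=> g a b g' a' b' [j [sj ja jb]] [j' [sj' ja' jb']] Ta Tb Tab.
  (* The cells [(i, j)] and [(i', j')] carry the same pair of symbols, so uniqueness identifies
     them. *)
  have [ij [_ uij]] := rc _ _ Logic.I Logic.I Tab.
  have [i Ii fi] := f_surj g Logic.I; have [i' Ii' fi'] := f_surj g' Logic.I.
  have ei : ij = (i, j).
    by apply: uij; split; rewrite //= /permute_columns fi ?ja ?jb.
  have ei' : ij = (i', j').
    by apply: uij; split; rewrite //= /permute_columns fi' ?ja' ?jb'.
  by rewrite -ja -ja'; move: ei'; rewrite ei => -[_ ->].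
Qed.
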